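(* Let $N\in\mathbb{N}$ and let $c_0,\rho_0>0$ and $\kappa_m,\tau_m>0$ for $m=1,\dots,N$. Define $$\tilde c_0=\frac{c_0}{\sqrt{1+\sum_{m=1}^N c_0^2\rho_0\kappa_m}},\qquad\tilde\tau_m=\tau_m(1-N\tilde c_0^2\rho_0\kappa_m),$$ and the attenuation coefficient of Nachman, Smith and Waag $$\alpha^*_{nsw}(\omega)=\frac{-i\omega}{c_0}\left[\frac{c_0}{\tilde c_0}\sqrt{\frac1N\sum_{m=1}^N\frac{1-i\tilde\tau_m\omega}{1-i\tau_m\omega}}-1\right],\qquad\omega\in\mathbb{R}.$$ If $\tilde\tau_m<\tau_m$ for all $m\in\{1,\dots,N\}$, then the kernel $K(\vec x,t)=\frac{1}{\sqrt{2\pi}}\mathcal{F}^{-1}\{e^{-\alpha^*_{nsw}(\cdot)|\vec x|}\}(t)$ is causal.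
   Context: Fourier convention: $\mathcal{F}^{-1}\{\hat f\}(t)=\frac{1}{\sqrt{2\pi}}\int_{\mathbb{R}}e^{-i\omega t}\hat f(\omega)\,d\omega$ (tempered distributions). The square root of a complex number is the root with non-negative real part. $K$ is causal if $t\mapsto K(\vec x,t)$ vanishes for $t<0$ for every $\vec x\in\mathbb{R}^3$. *)

(* Defs.v *)
From mathcomp Require Import all_boot all_order all_algebra.
From mathcomp Require Import all_classical all_reals all_analysis.
From mathcomp Require Import complex.
Set Implicit Arguments. Unset Strict Implicit. Unset Printing Implicit Defensive.
Import Order.TTheory GRing.Theory Num.Theory.
Local Open Scope ring_scope.
Local Open Scope complex_scope.

Section Defs.
Variable R : realType.

Definition cexp (z : R[i]) : R[i] :=
  (expR (complex.Re z))%:C * (cos (complex.Im z) +i* sin (complex.Im z)).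

(* principal square root: the root with non-negative real part
   (complex.sqrtc; on the negative real axis it picks i*sqrt|a|) *)
Definition csqrt (z : R[i]) : R[i] := sqrtc z.

Definition cintegral (f : R -> R[i]) : R[i] :=
  (Rintegral (@lebesgue_measure R) setT (fun t => complex.Re (f t)))
  +i* (Rintegral (@lebesgue_measure R) setT (fun t => complex.Im (f t))).

Definition eucl_norm3 (x : 'rV[R]_3) : R := Num.sqrt (\sum_(i < 3) x ord0 i ^+ 2).

Definition smooth (phi : R -> R) : Prop :=
  forall (n : nat) (t : R), derivable (derive1n n phi) t 1.

Definition test_fun_neg (phi : R -> R) : Prop :=
  smooth phi /\
  exists a b : R, b < 0 /\ forall t : R, (t < a \/ b < t) -> phi t = 0.

Definition inv_fourier_test (phi : R -> R) (w : R) : R[i] :=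
  ((Num.sqrt (2 * pi))^-1)%:C *
  cintegral (fun t => cexp (- ((w * t)%:C * 'i)) * (phi t)%:C).

(* action on a test function phi of the tempered distribution
   1/sqrt(2 pi) F^{-1}{ghat}, where ghat is a bounded continuous function:
   < F^{-1} ghat, phi > = < ghat, F^{-1} phi >. *)
Definition kernel_pairing (ghat : R -> R[i]) (phi : R -> R) : R[i] :=
  ((Num.sqrt (2 * pi))^-1)%:C *
  cintegral (fun w => ghat w * inv_fourier_test phi w).

(* K(x,.) = 1/sqrt(2pi) F^{-1}{Khat x} is causal: for every x, the
   distribution t |-> K(x,t) vanishes on (-oo,0) *)
Definition causal_kernel (Khat : 'rV[R]_3 -> R -> R[i]) : Prop :=
  forall (x : 'rV[R]_3) (phi : R -> R),
    test_fun_neg phi -> kernel_pairing (Khat x) phi = 0.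

Definition ctilde0 (N : nat) (c0 rho0 : R) (kappa : nat -> R) : R :=
  c0 / Num.sqrt (1 + \sum_(1 <= m < N.+1) c0 ^+ 2 * rho0 * kappa m).

Definition tautilde (N : nat) (c0 rho0 : R) (kappa tau : nat -> R) (m : nat) : R :=
  tau m * (1 - N%:R * (ctilde0 N c0 rho0 kappa) ^+ 2 * rho0 * kappa m).

Definition alpha_nsw (N : nat) (c0 rho0 : R) (kappa tau : nat -> R)
    (w : R) : R[i] :=
  (- (w%:C * 'i)) / c0%:C *
  ((c0 / ctilde0 N c0 rho0 kappa)%:C *
     csqrt ((N%:R)^-1%:C *
        \sum_(1 <= m < N.+1)
          ((1 - (tautilde N c0 rho0 kappa tau m * w)%:C * 'i) /
           (1 - (tau m * w)%:C * 'i)))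
   - 1).

Definition nsw_Khat (N : nat) (c0 rho0 : R) (kappa tau : nat -> R)
    (x : 'rV[R]_3) (w : R) : R[i] :=
  cexp (- (alpha_nsw N c0 rho0 kappa tau w * (eucl_norm3 x)%:C)).

End Defs.

(* Main.v *)
(* Put s = -i w. Up to the factor c0/ctilde0, the square root is the square root
   of B(s) = 1 + \sum_m c0^2 rho0 kappa_m / (1 + tau_m s), whose real part is at
   least 1 on the closed half-plane Re s >= 0. There E(s) = s (sqrt B(s) - 1) is
   bounded, because s (B(s) - 1) is, and so is its derivative. With L = |x|/c0,
   the function exp (t s - L E(s)) / (1 + s)^2 is thus holomorphic and
   O(exp (t Re s) / (1 + (Im s)^2)); for t < 0, shifting the line of integration
   to Re s = +oo shows that its integral over Re s = 0 vanishes. Replacing a test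
   function phi by psi = (1 - d/dt)^2 phi produces the factor (1 + s)^-2, and
   Fubini's theorem concludes. *)
Require Import Defs.
From mathcomp Require Import all_boot all_order all_algebra.
From mathcomp Require Import all_classical all_reals all_analysis.
From mathcomp Require Import complex.
From mathcomp Require Import measurable_realfun ring lra.
Set Implicit Arguments.
Unset Strict Implicit.
Unset Printing Implicit Defensive.
Import Order.TTheory GRing.Theory Num.Theory.
Import numFieldNormedType.Exports.
Local Open Scope ring_scope.
Local Open Scope classical_set_scope.
Local Open Scope complex_scope.

(** * Real integrals *)

Section real.
Variable R : realType.
Notation mu := (@lebesgue_measure R).

(** On the imaginary axis E is bounded, so exp (- L E) stays away from 0 there and is not
    integrable: neither Fubini nor a shift of the line applies to it directly. The factor (1 + s)^-2
    supplies the integrable majorant 1 / (1 + u^2), and the differential operator that pays for it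
    does not enlarge the support of the test function. The shift is done by real analysis. The
    integral J(y) over Re s = y is differentiated in y under the integral sign; the Cauchy-Riemann
    equations turn the integrand into an exact u-derivative, so J' = 0, and J(y) = O(exp (t y))
    forces the constant to be 0. The domination required here is the reason for bounding E' as well
    as E. E is bounded because of the - 1 in the attenuation coefficient: sqrt B - 1 = (B - 1) /
    (sqrt B + 1), and B - 1 decays like 1 / s. *)

Lemma integrable_oneDsqrV : mu.-integrable setT (EFin \o (fun u : R => (oneDsqr u)^-1)).
Proof.
apply/integrableP; split.
  by apply/measurable_EFinP; apply: continuous_measurable_fun; exact: continuous_oneDsqrV.
under eq_integral do rewrite /= ger0_norm ?invr_ge0 ?(le_trans ler01 (oneDsqr_ge1 _))//.
rewrite ge0_symfun_integralT; first last.
- by move=> u /=; rewrite /oneDsqr sqrrN.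
- exact: continuous_oneDsqrV.
- by move=> u; rewrite /= invr_ge0 (le_trans ler01 (oneDsqr_ge1 _)).
- rewrite -set_itvcy.
  by rewrite integral0y_oneDsqr -EFinM ltry.
Qed.

Lemma dominated_integrable (f k : R -> R) :
  measurable_fun setT f -> mu.-integrable setT (EFin \o k) ->
  (forall u, `|f u| <= k u) -> mu.-integrable setT (EFin \o f).
Proof.
move=> mf ik fk; apply: (@le_integrable _ _ _ mu setT _ _ (EFin \o k)) => //.
- exact/measurable_EFinP.
- by move=> u _ /=; rewrite lee_fin (le_trans (fk u))// ler_norm.
Qed.

Lemma dominated_cvg_Rintegral (f_ : nat -> R -> R) (f k : R -> R) :
  (forall n, measurable_fun setT (f_ n)) ->
  (forall u, f_ n u @[n --> \oo] --> f u) ->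
  mu.-integrable setT (EFin \o k) -> (forall n u, `|f_ n u| <= k u) ->
  \int[mu]_u f_ n u @[n --> \oo] --> \int[mu]_u f u.
Proof.
move=> mf ff ik fk.
have mfl : measurable_fun setT f.
  by apply: (measurable_fun_cvg (h := f_)) => // u _; exact: ff.
have il : mu.-integrable setT (EFin \o f).
  apply: (@dominated_integrable _ k) => // u.
  have cn : `|f_ n u| @[n --> \oo] --> `|f u| by apply: cvg_norm; exact: ff.
  rewrite -(cvg_lim (@Rhausdorff R) cn); apply: limr_le.
    by apply/cvg_ex; eexists; exact: cn.
  by apply: nearW => n; exact: fk.
rewrite /Rintegral; apply: fine_cvg; rewrite fineK; last exact: integrable_fin_num.
apply: (@dominated_cvg _ _ _ mu setT measurableT (fun n u => (f_ n u)%:E) _ (EFin \o k)).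
- by move=> n; apply/measurable_EFinP; exact: mf.
- by move=> u _; apply/fine_cvgP; split; [exact: nearW|exact: ff].
- by [].
- exact: ik.
- by move=> n u _ /=; rewrite lee_fin.
Qed.

(** The fundamental theorem on growing symmetric intervals leaves only boundary values of [g], and
    dominated convergence passes to the whole line. *)
Lemma Rintegral_derive_eq0 (g h k : R -> R) :
  (forall u : R, is_derive u (1 : R) g (h u)) -> continuous h ->
  mu.-integrable setT (EFin \o k) -> (forall u, `|h u| <= k u) ->
  g n%:R @[n --> \oo] --> (0 : R) -> g (- n%:R) @[n --> \oo] --> (0 : R) ->
  \int[mu]_u h u = 0.
Proof.
move=> dg ch ik hk gp gm.
have cg : continuous g.
  by move=> u; apply/differentiable_continuous/derivable1_diffP; have [] := dg u.
(* The index [n.+1] keeps every interval nondegenerate, as the fundamental theorem requires. *)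
pose I (n : nat) := `[(- n.+1%:R)%R, n.+1%:R]%classic : set R.
have ftc n : \int[mu]_u (h \_ (I n)) u = g n.+1%:R - g (- n.+1%:R).
  rewrite -Rintegral_mkcond /Rintegral (@continuous_FTC2 _ h g).
  - by [].
  - by rewrite (@lt_trans _ _ 0) ?oppr_lt0 ?ltr0n.
  - exact: continuous_subspaceT.
  - split.
    + by move=> u _; have [] := dg u.
    + by apply: cvg_at_right_filter; exact: cg.
    + by apply: cvg_at_left_filter; exact: cg.
  - by move=> u _; rewrite derive1E; have [] := dg u.
have c1 : \int[mu]_u (h \_ (I n)) u @[n --> \oo] --> \int[mu]_u h u.
  apply: (@dominated_cvg_Rintegral _ _ k) => //.
  - move=> n; have mI : measurable (I n) by exact: measurable_itv.
    apply/(measurable_restrictT _ mI)/measurable_funTS.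
    exact: continuous_measurable_fun.
  - move=> u; apply: cvg_near_cst.
    near=> n; rewrite patchE; case: ifPn => //.
    rewrite notin_setE /I /= in_itv /= -ler_norml => /negP; rewrite -ltNge => nu.
    exfalso; move: nu; apply/negP; rewrite -leNgt.
    rewrite (@le_trans _ _ n%:R) ?ler_nat//.
    by near: n; exact: nbhs_infty_ger.
  - by move=> n u; rewrite patchE; case: ifP => // _; rewrite normr0 (le_trans _ (hk u)).
have c2 : \int[mu]_u (h \_ (I n)) u @[n --> \oo] --> (0 : R).
  under eq_fun do rewrite ftc.
  rewrite -(subrr (0 : R)); apply: cvgB.
  - by move: gp; rewrite -(cvg_shiftS (fun n => g n%:R)).
  - by move: gm; rewrite -(cvg_shiftS (fun n => g (- n%:R))).
exact: (cvg_unique _ c1 c2).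
Unshelve. all: by end_near. Qed.

(* [f], [g] and their common derivative [h] are (up to signs) the real and
   imaginary parts of a holomorphic function and of its derivative. *)
Lemma half_plane_Rintegral_eq0 (f g h : R -> R -> R) (M t : R) :
  t < 0 ->
  (forall y u : R, 0 <= y -> is_derive y (1 : R) (f ^~ u) (h y u)) ->
  (forall y u : R, 0 <= y -> is_derive u (1 : R) (g y) (h y u)) ->
  (forall y : R, 0 <= y -> continuous (f y)) ->
  (forall y : R, 0 <= y -> continuous (h y)) ->
  (forall y u : R, 0 <= y -> `|f y u| <= expR (t * y) * (M * (oneDsqr u)^-1)) ->
  (forall y u : R, 0 <= y -> `|g y u| <= M * (oneDsqr u)^-1) ->
  (forall y u : R, 0 <= y -> `|h y u| <= M * (oneDsqr u)^-1) ->
  \int[mu]_u f 0 u = 0.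
Proof.
move=> t0 df dg cf ch bf bg bh.
pose k u : R := M * (oneDsqr u)^-1.
have ik : mu.-integrable setT (EFin \o k).
  exact: (integrableZl measurableT M integrable_oneDsqrV).
have bfk (y u : R) : 0 <= y -> `|f y u| <= k u.
  move=> y0; apply: (le_trans (bf y u y0)).
  rewrite -[leRHS]mul1r ler_wpM2r//; first exact: le_trans (normr_ge0 _) (bg _ u (lexx 0)).
  by rewrite -expR0 ler_expR mulr_le0_ge0// ltW.
have k0 u : 0 <= k u by exact: le_trans (normr_ge0 _) (bg _ u (lexx 0)).
have mf (y : R) : 0 <= y -> measurable_fun setT (f y).
  by move=> y0; apply: continuous_measurable_fun; exact: cf.

have If (y : R) : 0 <= y -> mu.-integrable setT (EFin \o f y).
  by move=> y0; apply: (@dominated_integrable _ k) => // [|u]; [exact: mf|exact: bfk].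
have k_cvg0 (x : nat -> R) : (forall n, n%:R <= `|x n|) ->
    forall y : R, 0 <= y -> g y (x n) @[n --> \oo] --> (0 : R).
  move=> xn y y0; apply/cvgr0Pnorm_le => e e0.
  have M0 : 0 <= M.
    by have := k0 0; rewrite /k /oneDsqr expr0n addr0 invr1 mulr1.
  near=> n; apply: (le_trans (bg _ _ y0)).
  rewrite ler_pdivrMr ?(lt_le_trans ltr01 (oneDsqr_ge1 _))//.
  rewrite mulrC -ler_pdivrMr// (@le_trans _ _ n%:R)//.
    by near: n; exact: nbhs_infty_ger.
  rewrite (le_trans (xn n))// /oneDsqr -(real_normK (num_real (x n))).
  by have := sqr_ge0 (`|x n| - 1); rewrite sqrrB1; have := normr_ge0 (x n); nra.
(* Read as the u-derivative of [g y], the function [h y] integrates to a difference of limits of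
   [g y], both 0. *)
have Ih (y : R) : 0 <= y -> \int[mu]_u h y u = 0.
  move=> y0; apply: (@Rintegral_derive_eq0 (g y) _ k) => //.
  - by move=> u; exact: dg.
  - exact: ch.
  - by move=> u; exact: bh.
  - by apply: k_cvg0 => // n; rewrite normr_nat.
  - by apply: k_cvg0 => // n; rewrite normrN normr_nat.
pose J (y : R) : R := \int[mu]_u f y u.
(* Now [h] is read as the y-derivative of [f]. Differentiation under the integral needs an open
   interval around [y] inside the half-line, so the endpoint 0 is left aside. *)
have dJ (y : R) : 0 < y -> is_derive y (1 : R) J 0.
  move=> y0.
  have yI : `]0, (y + 1)%R[%classic y by rewrite /= in_itv /= y0 ltrDl ltr01.
  have d1E (z u : R) : 0 <= z -> partial1of2 f z u = h z u.
    by move=> z0; rewrite partial1of2E; have [] := df z u z0.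
  have I0 (z : R) : `]0, (y + 1)%R[%classic z -> 0 <= z.
    by rewrite /= in_itv /= => /andP[/ltW].
  have A1 (z : R) : `]0, (y + 1)%R[%classic z -> mu.-integrable setT (EFin \o f z).
    by move=> /I0 z0; exact: If.
  have A2 (z u : R) : `]0, (y + 1)%R[%classic z -> setT u -> derivable (f ^~ u) z 1.
    by move=> /I0 z0 _; have [] := df z u z0.
  have A3 (z u : R) : `]0, (y + 1)%R[%classic z -> setT u -> `|partial1of2 f z u| <= k u.
    by move=> /I0 z0 _; rewrite d1E//; exact: bh.
  split; first exact: (derivable_under_integral measurableT yI A1 A2 k0 ik A3).
  rewrite -derive1E (differentiation_under_integral measurableT yI A1 A2 k0 ik A3).
  rewrite -[RHS](Ih y (ltW y0)); apply: eq_Rintegral => u _.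
  by rewrite d1E// ltW.
(* Composing with [expR] moves the half-line onto all of R, where a zero derivative gives a
   constant. *)
have J1 (y : R) : 0 < y -> J y = J 1.
  move=> y0; rewrite -(lnK y0) -[in RHS]expR0.
  apply: (@is_derive_0_is_cst _ (J \o expR)) => x.
  rewrite -[X in is_derive _ _ _ X](mul0r (expR x)); apply: is_derive1_comp.
  by apply: dJ; exact: expR_gt0.
have Jb (y : R) : 0 < y -> `|J 1| <= expR (t * y) * \int[mu]_u k u.
  move=> y0; rewrite -(J1 _ y0) -RintegralZl//.
  apply: le_trans (le_normr_Rintegral measurableT (If _ (ltW y0))) _.
  apply: le_Rintegral => //.
  - by apply: integrable_norm; exact/If/ltW.
  - exact: (integrableZl measurableT _ ik).
  - by move=> u _; exact/bf/ltW.
have J10 : J 1 = 0.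
  apply/eqP; rewrite -normr_le0 leNgt; apply/negP => c0.
  set K := \int[mu]_u k u in Jb.
  have K0 : 0 < K.
    by rewrite -(pmulr_rgt0 _ (expR_gt0 (t * 1))); exact: lt_le_trans (Jb _ ltr01).
  set c := `|J 1| in Jb c0.
  (* At this height exp (t y) = exp (- K / c), and the bound reads c exp (K / c) <= K, against exp
     (K / c) >= 1 + K / c. *)
  have y0 : 0 < K / (c * - t) by rewrite divr_gt0// mulr_gt0// oppr_gt0.
  have := Jb _ y0.
  have [cn0 tn0] : c != 0 /\ t != 0 by rewrite lt0r_neq0// ltr0_neq0.
  have -> : t * (K / (c * - t)) = - (K / c) by field; rewrite cn0 tn0.

  rewrite expRN mulrC ler_pdivlMr ?expR_gt0//; apply/negP; rewrite -ltNge.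
  have := expR_ge1Dx (K / c); rewrite -(ler_pM2l c0) mulrDr mulrCA divff ?lt0r_neq0// !mulr1.
  by apply: lt_le_trans; rewrite ltrDr.
(* The boundary line y = 0 is reached as the limit of the lines y = 1 / (n + 1). *)
have lim0 : J n.+1%:R^-1 @[n --> \oo] --> J 0.
  apply: (@dominated_cvg_Rintegral _ _ k) => //.
  - by move=> n; exact: mf.
  - move=> u.
    have c0 : {for 0, continuous (f ^~ u)}.
      by apply/differentiable_continuous/derivable1_diffP; have [] := df 0 u (lexx 0).
    exact: (cvg_comp (fun n : nat => (n.+1%:R)^-1 : R) (f ^~ u) (@cvg_harmonic R) c0).
  - by move=> n u; exact: bfk.
have lim1 : J n.+1%:R^-1 @[n --> \oo] --> (0 : R).
  by apply: cvg_near_cst; apply: nearW => n; rewrite J1 ?J10// invr_gt0 ltr0n.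
exact: (cvg_unique _ lim0 lim1).
Unshelve. all: by end_near. Qed.
End real.

(** * Complex differentiation along curves *)

Section calculus.
Variable R : realType.
Local Notation C := R[i].
Local Notation Re := (@complex.Re R).
Local Notation Im := (@complex.Im R).

Lemma Re_mul (x y : C) : Re (x * y) = Re x * Re y - Im x * Im y.
Proof. by case: x y => [a b] [c d]. Qed.

Lemma Im_mul (x y : C) : Im (x * y) = Re x * Im y + Im x * Re y.
Proof. by case: x y => [a b] [c d]. Qed.

Lemma Re_add (x y : C) : Re (x + y) = Re x + Re y.
Proof. by case: x y => [a b] [c d]. Qed.

Lemma Im_add (x y : C) : Im (x + y) = Im x + Im y.
Proof. by case: x y => [a b] [c d]. Qed.

Lemma Re_opp (x : C) : Re (- x) = - Re x.
Proof. by case: x. Qed.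

Lemma Im_opp (x : C) : Im (- x) = - Im x.
Proof. by case: x. Qed.

Lemma Re_inv (x : C) : Re x^-1 = Re x / (Re x ^+ 2 + Im x ^+ 2).
Proof. by case: x. Qed.

Lemma Im_inv (x : C) : Im x^-1 = - (Im x / (Re x ^+ 2 + Im x ^+ 2)).
Proof. by case: x. Qed.

Lemma Re_of_real (x : R) : Re x%:C = x.
Proof. by []. Qed.

Lemma Im_of_real (x : R) : Im x%:C = 0.
Proof. by []. Qed.

Definition cpartE := (Re_mul, Im_mul, Re_add, Im_add, Re_opp, Im_opp).

Lemma complexP (x y : C) : Re x = Re y -> Im x = Im y -> x = y.
Proof. by case: x y => [a b] [c d] /= -> ->. Qed.

Lemma sqr_modulus_gt0 (x : C) : x != 0 -> 0 < Re x ^+ 2 + Im x ^+ 2.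
Proof.
case: x => a b /=; rewrite eq_complex /= negb_and => /orP[] h.
  by rewrite ltr_pwDl ?sqr_ge0// exprn_even_gt0.
by rewrite ltr_wpDl ?sqr_ge0// exprn_even_gt0.
Qed.

(** Paths are differentiated by coordinates because [cintegral] is defined by coordinates and the
    integral lemmas concern real functions. *)
Definition curve_derive (g : R -> C) (t : R) (d : C) : Prop :=
  is_derive t (1 : R) (fun x => Re (g x)) (Re d) /\
  is_derive t (1 : R) (fun x => Im (g x)) (Im d).

Lemma curve_derive_cst (c : C) t : curve_derive (fun=> c) t 0.
Proof. by split; exact: is_derive_cst. Qed.

Lemma curve_deriveD (g h : R -> C) t d e :
  curve_derive g t d -> curve_derive h t e ->
  curve_derive (fun x => g x + h x) t (d + e).
Proof.
move=> [g1 g2] [h1 h2]; split; rewrite cpartE.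
  rewrite (_ : (fun x => _) = (fun x => Re (g x)) + (fun x => Re (h x))).
    exact: is_deriveD.
  by apply/funext => x; rewrite cpartE.
rewrite (_ : (fun x => _) = (fun x => Im (g x)) + (fun x => Im (h x))).
  exact: is_deriveD.
by apply/funext => x; rewrite cpartE.
Qed.

Lemma curve_deriveM (g h : R -> C) t d e :
  curve_derive g t d -> curve_derive h t e ->
  curve_derive (fun x => g x * h x) t (d * h t + g t * e).
Proof.
move=> [g1 g2] [h1 h2]; split; rewrite !cpartE.
  rewrite (_ : (fun x => _) = (fun x => Re (g x)) * (fun x => Re (h x)) -
    (fun x => Im (g x)) * (fun x => Im (h x))).
    by apply: is_derive_eq; rewrite /GRing.scale /=; ring.
  by apply/funext => x; rewrite cpartE.
rewrite (_ : (fun x => _) = (fun x => Re (g x)) * (fun x => Im (h x)) +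
    (fun x => Im (g x)) * (fun x => Re (h x))).
  apply: (is_derive_eq (is_deriveD (is_deriveM g1 h2) (is_deriveM g2 h1))).
  by rewrite /GRing.scale /=; ring.
by apply/funext => x; rewrite cpartE.
Qed.

Lemma derive_sqr_modulus (g : R -> C) t d : curve_derive g t d ->
  is_derive t (1 : R) (fun x => Re (g x) ^+ 2 + Im (g x) ^+ 2)
    (2 * (Re (g t) * Re d + Im (g t) * Im d)).
Proof.
move=> [g1 g2].
apply: (is_derive_eq (is_deriveD (is_deriveX 2 g1) (is_deriveX 2 g2))).
by rewrite /GRing.scale /= !expr1; ring.
Qed.

Lemma curve_deriveV (g : R -> C) t d : g t != 0 ->
  curve_derive g t d -> curve_derive (fun x => (g x)^-1) t (- d / g t ^+ 2).
Proof.
move=> gt0 [g1 g2].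
have n0 := lt0r_neq0 (sqr_modulus_gt0 gt0).
pose N x : R := Re (g x) ^+ 2 + Im (g x) ^+ 2.
have dN := derive_sqr_modulus (conj g1 g2); rewrite -/N in dN.
have n1 : N t != 0 by [].
have dV := is_deriveV n1 dN.
split; rewrite expr2 invfM !(cpartE, Re_inv, Im_inv).
  rewrite (_ : (fun x => _) = (fun x => Re (g x)) * (fun x => (N x)^-1)).
    apply: is_derive_eq; rewrite /GRing.scale /= /N; field.
    by rewrite n0.
  by apply/funext => x; rewrite Re_inv.
rewrite (_ : (fun x => _) = - ((fun x => Im (g x)) * (fun x => (N x)^-1))).
  apply: is_derive_eq; rewrite /GRing.scale /= /N; field.
  by rewrite n0.
by apply/funext => x; rewrite Im_inv.
Qed.

Lemma curve_derive_exp (g : R -> C) t d :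
  curve_derive g t d -> curve_derive (fun x => cexp (g x)) t (cexp (g t) * d).
Proof.
move=> [g1 g2].
have e1 : is_derive t (1 : R) (fun x => expR (Re (g x))) (expR (Re (g t)) * Re d).
  exact: is_derive1_comp.
have c1 : is_derive t (1 : R) (fun x => cos (Im (g x))) (- sin (Im (g t)) * Im d).
  exact: is_derive1_comp.
have s1 : is_derive t (1 : R) (fun x => sin (Im (g x))) (cos (Im (g t)) * Im d).
  exact: is_derive1_comp.
split.
  rewrite (_ : (fun x => _) = (fun x => expR (Re (g x))) * (fun x => cos (Im (g x)))).
    by apply: is_derive_eq; rewrite /GRing.scale /cexp !cpartE /=; ring.
  by apply/funext => x; rewrite /cexp !cpartE /=; rewrite mul0r subr0.
rewrite (_ : (fun x => _) = (fun x => expR (Re (g x))) * (fun x => sin (Im (g x)))).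
  by apply: is_derive_eq; rewrite /GRing.scale /cexp !cpartE /=; ring.
by apply/funext => x; rewrite /cexp !cpartE /=; rewrite mul0r addr0.
Qed.

Lemma sqrtc_parts (z : C) :
  Re (sqrtc z) ^+ 2 - Im (sqrtc z) ^+ 2 = Re z /\
  2 * (Re (sqrtc z) * Im (sqrtc z)) = Im z.
Proof.
have := sqr_sqrtc z; move: (sqrtc z) => w <-.
by split; rewrite expr2 !cpartE; ring.
Qed.

Lemma Re_sqrtc_gt0 (z : C) : 0 < Re z -> 0 < Re (sqrtc z).
Proof.
case: z => a b /= a0; rewrite sqrtr_gt0 divr_gt0//.
by rewrite ltr_wpDl// sqrtr_ge0.
Qed.

(** Differentiability is read off the explicit formula for the real part and then off 2 P Q = Im g
    for the imaginary part; the value of the derivative follows by differentiating the square. *)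
Lemma curve_derive_sqrtc (g : R -> C) t d : 0 < Re (g t) ->
  curve_derive g t d ->
  curve_derive (fun x => sqrtc (g x)) t (d / (2 * sqrtc (g t))).
Proof.
move=> a0 [g1 g2].
pose N x : R := Re (g x) ^+ 2 + Im (g x) ^+ 2.
have dN := derive_sqr_modulus (conj g1 g2); rewrite -/N in dN.
have N0 : 0 < N t by rewrite ltr_pwDl ?sqr_ge0// exprn_gt0.
pose P x := Re (sqrtc (g x)); pose Q x := Im (sqrtc (g x)).
have P0 : 0 < P t by exact: Re_sqrtc_gt0.
have dr := is_derive1_comp (is_derive1_sqrt N0) dN.
(* The real part of the principal root is the square root of (|g| + Re g) / 2. *)
pose S : R -> R := 2^-1 \*: (Num.sqrt \o N + (fun x => Re (g x))).
have dS := is_deriveZ 2^-1 (is_deriveD dr g1); rewrite -/S in dS.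
have PE : P = Num.sqrt \o S.
  apply/funext => x; rewrite /P /S /N /=.
  rewrite /P /S /N /= !fctE /GRing.scale /=; case: (g x) => a b /=. by rewrite mulrC.
have S0 : 0 < S t by rewrite -sqrtr_gt0 -[Num.sqrt _]/((Num.sqrt \o S) t) -PE.
have := is_derive1_comp (is_derive1_sqrt S0) dS; rewrite -PE.
(* Only the existence of the derivative is kept; its expression is forgotten. *)
set p := (X in is_derive _ _ _ X); move: p => p dP.
have n2 : (2 \*: P) t != 0.
  by rewrite /GRing.scale /= mulf_neq0// lt0r_neq0.
have := is_deriveM g2 (is_deriveV n2 (is_deriveZ 2 dP)).
set q := (X in is_derive _ _ _ X); move: q => q dPV.
(* The quotient formula Q = Im g / (2 P) holds only where P does not vanish, hence the passage to a
   neighbourhood of [t]. *)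
have dQ : is_derive t (1 : R) Q q.
  apply: near_eq_is_derive dPV.
  have cP : {for t, continuous P}.
    by apply/differentiable_continuous/derivable1_diffP; have [] := dP.
  have : \forall x \near t, 0 < P x by exact: (cvgr_gt _ cP).
  apply: filterS => x Px; rewrite !fctE /GRing.scale /=; have [_ <-] := sqrtc_parts (g x).
  by rewrite -/(P x) -/(Q x) -[2 *: P x]/(2 * P x); field; rewrite lt0r_neq0.
(* Together with [e2] this says 2 (P + i Q) (p + i q) = d, obtained from the derivative of (P + i
   Q)^2 = g. *)
have e1 : 2 * (P t * p - Q t * q) = Re d.
  have [_ <-] := g1.
  have -> : (fun x => Re (g x)) = P ^+ 2 - Q ^+ 2.
    by apply/funext => x; have [<- _] := sqrtc_parts (g x).
  have [_ ->] := is_deriveB (is_deriveX 2 dP) (is_deriveX 2 dQ).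
  by rewrite /GRing.scale /= !expr1; ring.
have e2 : 2 * (P t * q + Q t * p) = Im d.
  have [_ <-] := g2.
  have -> : (fun x => Im (g x)) = 2 \*: (P * Q).
    by apply/funext => x; have [_ <-] := sqrtc_parts (g x).
  have [_ ->] := is_deriveZ 2 (is_deriveM dP dQ).
  by rewrite /GRing.scale /=; ring.
have w0 : sqrtc (g t) != 0.
  by apply/eqP => w0; move: P0; rewrite /P w0 ltxx.
suff -> : d / (2 * sqrtc (g t)) = p +i* q by split.
apply: (canLR (mulfK _)); first by rewrite mulf_neq0// pnatr_eq0.
rewrite (_ : 2 = 2%:C) ?rmorph_nat//.
by apply: complexP; rewrite !cpartE /= -/(P t) -/(Q t) -?e1 -?e2; ring.
Qed.

(* Complex differentiability at [s], tested on curves: taking horizontal and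
   vertical lines gives both partial derivatives of [f]. *)
Definition cderive (f : C -> C) (s d : C) : Prop :=
  forall g t e, g t = s -> curve_derive g t e ->
  curve_derive (fun x => f (g x)) t (d * e).

Lemma cderive_eq (f : C -> C) s d e : cderive f s d -> d = e -> cderive f s e.
Proof. by move=> h <-. Qed.

Lemma cderive_cst (c s : C) : cderive (fun=> c) s 0.
Proof. by move=> g t e _ _; rewrite mul0r; exact: curve_derive_cst. Qed.

Lemma cderive_id (s : C) : cderive id s 1.
Proof. by move=> g t e _; rewrite mul1r. Qed.

Lemma cderiveD (f1 f2 : C -> C) s d1 d2 : cderive f1 s d1 -> cderive f2 s d2 ->
  cderive (fun z => f1 z + f2 z) s (d1 + d2).
Proof.
by move=> h1 h2 g t e gt ge; rewrite mulrDl; apply: curve_deriveD; [exact: h1|exact: h2].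
Qed.

Lemma cderiveM (f1 f2 : C -> C) s d1 d2 : cderive f1 s d1 -> cderive f2 s d2 ->
  cderive (fun z => f1 z * f2 z) s (d1 * f2 s + f1 s * d2).
Proof.
move=> h1 h2 g t e gt ge.
rewrite (_ : _ * e = d1 * e * f2 s + f1 s * (d2 * e)) -?gt; last by ring.
by apply: curve_deriveM; [exact: h1|exact: h2].
Qed.

Lemma cderiveZ (c : C) (f : C -> C) s d : cderive f s d ->
  cderive (fun z => c * f z) s (c * d).
Proof.
by move=> h; have := cderiveM (@cderive_cst c s) h; rewrite mul0r add0r.
Qed.

Lemma cderiveV (f : C -> C) s d : f s != 0 -> cderive f s d ->
  cderive (fun z => (f z)^-1) s (- d / f s ^+ 2).
Proof.
move=> f0 h g t e gt ge; rewrite mulrAC mulNr -gt; apply: curve_deriveV.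
  by rewrite gt.
exact: h.
Qed.

Lemma cderive_exp (f : C -> C) s d : cderive f s d ->
  cderive (fun z => cexp (f z)) s (cexp (f s) * d).
Proof.
by move=> h g t e gt ge; rewrite -mulrA -gt; apply: curve_derive_exp; exact: h.
Qed.

Lemma cderive_sqrtc (f : C -> C) s d : 0 < Re (f s) -> cderive f s d ->
  cderive (fun z => sqrtc (f z)) s (d / (2 * sqrtc (f s))).
Proof.
move=> f0 h g t e gt ge; rewrite mulrAC -gt; apply: curve_derive_sqrtc.
  by rewrite gt.
exact: h.
Qed.

Lemma cderive_sum (I : eqType) (r : seq I) (f : I -> C -> C) (d : I -> C) s :
  (forall i, i \in r -> cderive (f i) s (d i)) ->
  cderive (fun z => \sum_(i <- r) f i z) s (\sum_(i <- r) d i).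
Proof.
elim: r => [|i r IH] h.
  rewrite big_nil (_ : (fun z => _) = fun=> 0); first exact: cderive_cst.
  by apply/funext => z; rewrite big_nil.
rewrite big_cons (_ : (fun z => _) = fun z => f i z + \sum_(i <- r) f i z).
  apply: cderiveD; first by apply: h; rewrite mem_head.
  by apply: IH => k kr; apply: h; rewrite in_cons kr orbT.
by apply/funext => z; rewrite big_cons.
Qed.

Lemma curve_derive_continuous (g : R -> C) :
  (forall t, exists d, curve_derive g t d) ->
  continuous (fun t => Re (g t)) /\ continuous (fun t => Im (g t)).
Proof.
by move=> h; split => t; have [d [[d1 _] [d2 _]]] := h t;
  apply/differentiable_continuous/derivable1_diffP.
Qed.
End calculus.

(** * Modulus and exponential *)

Section modulus.
Variable R : realType.
Local Notation C := R[i].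
Local Notation Re := (@complex.Re R).
Local Notation Im := (@complex.Im R).
Local Notation normc := (@ComplexField.Normc.normc R).

Lemma normc_parts (z : C) : normc z = Num.sqrt (Re z ^+ 2 + Im z ^+ 2).
Proof. by case: z. Qed.

Lemma normc_ge0 (z : C) : 0 <= normc z.
Proof. by rewrite normc_parts sqrtr_ge0. Qed.

Lemma sqr_normc_parts (z : C) : normc z ^+ 2 = Re z ^+ 2 + Im z ^+ 2.
Proof. by rewrite normc_parts sqr_sqrtr// addr_ge0 ?sqr_ge0. Qed.

Lemma norm_Re_le_normc (z : C) : `|Re z| <= normc z.
Proof. by rewrite normc_parts -sqrtr_sqr ler_wsqrtr// lerDl sqr_ge0. Qed.

Lemma norm_Im_le_normc (z : C) : `|Im z| <= normc z.
Proof. by rewrite normc_parts -sqrtr_sqr ler_wsqrtr// lerDr sqr_ge0. Qed.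

Lemma Re_le_normc (z : C) : Re z <= normc z.
Proof. exact: le_trans (ler_norm _) (norm_Re_le_normc z). Qed.

Lemma normc_real (x : R) : normc x%:C = `|x|.
Proof. by rewrite normc_parts /= expr0n addr0 sqrtr_sqr. Qed.

Lemma normc_sum (I : eqType) (r : seq I) (f : I -> C) (b : I -> R) :
  (forall i, i \in r -> normc (f i) <= b i) ->
  normc (\sum_(i <- r) f i) <= \sum_(i <- r) b i.
Proof.
elim: r => [|i r IH] h; first by rewrite !big_nil ComplexField.Normc.normc0.
rewrite !big_cons; apply: le_trans (le_normcD _ _) _; apply: lerD.
  by apply: h; rewrite mem_head.
by apply: IH => k kr; apply: h; rewrite in_cons kr orbT.
Qed.

Lemma normc_cexp (z : C) : normc (cexp z) = expR (Re z).
Proof.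
rewrite /cexp ComplexField.Normc.normcM normc_real ger0_norm ?expR_ge0//.
by rewrite normc_parts /= cos2Dsin2 sqrtr1 mulr1.
Qed.

Lemma cexpD (x y : C) : cexp (x + y) = cexp x * cexp y.
Proof.
rewrite /cexp !cpartE expRD cosD sinD.
by apply: complexP; rewrite !cpartE /=; ring.
Qed.
End modulus.

(** * The transformed kernel on the right half-plane *)

Section relaxation.
Variable R : realType.
Local Notation C := R[i].
Local Notation Re := (@complex.Re R).
Local Notation Im := (@complex.Im R).
Local Notation normc := (@ComplexField.Normc.normc R).
Local Notation mu := (@lebesgue_measure R).

(** * A single relaxation factor 1 / (1 + a s) *)

Section one_mode.
Variables (a : R) (s : C).
Hypotheses (a0 : 0 < a) (s0 : 0 <= Re s).

Lemma Re_1DM_ge1 : 1 <= Re (1 + a%:C * s).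
Proof. by rewrite !cpartE /= mul0r subr0 lerDl mulr_ge0// ltW. Qed.

Lemma neq0_1DM : 1 + a%:C * s != 0.
Proof.
by apply/eqP => e; have := Re_1DM_ge1; rewrite e /= ler10.
Qed.

Lemma normc_1DM_ge1 : 1 <= normc (1 + a%:C * s).
Proof. exact: le_trans Re_1DM_ge1 (Re_le_normc _). Qed.

Lemma normc_1DMV_le1 : normc (1 + a%:C * s)^-1 <= 1.
Proof.
rewrite ComplexField.Normc.normcV invf_le1 ?normc_1DM_ge1//.
exact: lt_le_trans ltr01 normc_1DM_ge1.
Qed.

(** As Re (a s) >= 0, adding 1 can only increase the modulus: |a s| <= |1 + a s|. *)
Lemma normc_div_1DM_le : normc (s / (1 + a%:C * s)) <= a^-1.
Proof.
have n0 := lt_le_trans ltr01 normc_1DM_ge1.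
rewrite ComplexField.Normc.normcM ComplexField.Normc.normcV.
rewrite ler_pdivrMr// mulrC ler_pdivlMr// -[a in X in X <= _]gtr0_norm// -normc_real.
rewrite -ComplexField.Normc.normcM mulrC normc_parts [leRHS]normc_parts ler_wsqrtr//.
rewrite !cpartE /= !mul0r !addr0 !subr0 add0r lerD2r.
by rewrite ler_sqr ?nnegrE ?lerDr ?addr_ge0 ?mulr_ge0// ltW.
Qed.

Lemma Re_1DMV_ge0 : 0 <= Re (1 + a%:C * s)^-1.
Proof.
rewrite Re_inv divr_ge0 ?addr_ge0 ?sqr_ge0//.
exact: le_trans ler01 Re_1DM_ge1.
Qed.

Lemma cderive_1DMV :
  cderive (fun z => (1 + a%:C * z)^-1) s (- a%:C * (1 + a%:C * s)^-1 ^+ 2).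
Proof.
rewrite exprVn; apply: cderiveV; first exact: neq0_1DM.
rewrite -[a%:C in X in cderive _ _ X]mulr1 -[X in cderive _ _ X]add0r.
by apply: cderiveD; [exact: cderive_cst|apply: cderiveZ; exact: cderive_id].
Qed.
End one_mode.

Variables (I : eqType) (r : seq I) (w tau : I -> R).
Hypothesis w0 : forall i, i \in r -> 0 < w i.
Hypothesis tau0 : forall i, i \in r -> 0 < tau i.

(* With [w i = c0^2 rho0 kappa_i] this is the B(s) of the header. *)
Definition compliance (s : C) : C :=
  1 + \sum_(i <- r) (w i)%:C * (1 + (tau i)%:C * s)^-1.

Definition dcompliance (s : C) : C :=
  \sum_(i <- r) (w i)%:C * (- (tau i)%:C * (1 + (tau i)%:C * s)^-1 ^+ 2).

(** The function E of the overview; at s = -i u it is c0 times the Nachman-Smith-Waag coefficient at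
    u. *)
Definition attenuation (s : C) : C := s * (sqrtc (compliance s) - 1).

Definition dattenuation (s : C) : C :=
  sqrtc (compliance s) - 1 + s * (dcompliance s / (2 * sqrtc (compliance s))).

(** On the half-plane, [W] bounds |B - 1| and [T] bounds |s (B - 1)|, mode by mode. *)
Let W := \sum_(i <- r) w i.
Let T := \sum_(i <- r) w i / tau i.

(** * Bounds and derivatives of B and E at a point *)

Section at_s.
Variable s : C.
Hypothesis s0 : 0 <= Re s.

(** Inversion preserves the right half-plane, so each mode adds a non-negative real part to 1. *)
Lemma Re_compliance_ge1 : 1 <= Re (compliance s).
Proof.
rewrite Re_add /= lerDl.
have: forall i, i \in r -> 0 <= Re ((w i)%:C * (1 + (tau i)%:C * s)^-1).
  move=> i ir; rewrite Re_mul /= mul0r subr0; apply: mulr_ge0; first exact/ltW/w0.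
  by apply: Re_1DMV_ge0 => //; exact: tau0.
elim: r => [|i l IH] h; first by rewrite big_nil.
rewrite big_cons Re_add addr_ge0 ?h ?mem_head//; apply: IH => k kl.
by apply: h; rewrite in_cons kl orbT.
Qed.

(** With sqrt B = p + i q, one has p^2 = Re B + q^2 >= 1 and p > 0. *)
Lemma Re_sqrtc_compliance_ge1 : 1 <= Re (sqrtc (compliance s)).
Proof.
have b1 := Re_compliance_ge1.
have := Re_sqrtc_gt0 (lt_le_trans ltr01 b1).
have [e _] := sqrtc_parts (compliance s); move: e b1 => <-.
set p := Re _; set q := Im _ => b1 p0.
by rewrite leNgt; apply/negP => p1; have := sqr_ge0 q; nra.
Qed.

Lemma normc_sqrtc_compliance_ge1 : 1 <= normc (sqrtc (compliance s)).
Proof. exact: le_trans Re_sqrtc_compliance_ge1 (Re_le_normc _). Qed.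

Lemma sqrtc_compliance_neq0 : sqrtc (compliance s) != 0.
Proof.
by apply/eqP => e; have := Re_sqrtc_compliance_ge1; rewrite e /= ler10.
Qed.

Lemma normc_sqrtc_complianceD1_ge1 : 1 <= normc (sqrtc (compliance s) + 1).
Proof.
apply: le_trans (Re_le_normc _); rewrite Re_add /= lerDr.
exact: le_trans ler01 Re_sqrtc_compliance_ge1.
Qed.

(** B - 1 = (sqrt B - 1) (sqrt B + 1), and the last factor has modulus at least 1. The multiplier
    [u] is [s] for the bound on E and 1 for the bound on E'. *)
Lemma normc_mul_sqrtc_complianceB1_le (u : C) (b : R) :
  normc (u * \sum_(i <- r) (w i)%:C * (1 + (tau i)%:C * s)^-1) <= b ->
  normc (u * (sqrtc (compliance s) - 1)) <= b.
Proof.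
have D0 := lt_le_trans ltr01 normc_sqrtc_complianceD1_ge1.
apply: le_trans; rewrite -[leLHS]mulr1.
rewrite (_ : \sum_(i <- r) _ = (sqrtc (compliance s) - 1) * (sqrtc (compliance s) + 1)).
  rewrite mulrA [leRHS]ComplexField.Normc.normcM.
  by rewrite ler_wpM2l ?normc_ge0// normc_sqrtc_complianceD1_ge1.
by rewrite -subr_sqr sqr_sqrtc expr1n /compliance addrAC subrr add0r.
Qed.

Lemma normc_attenuation_le : normc (attenuation s) <= T.
Proof.
apply: normc_mul_sqrtc_complianceB1_le; rewrite mulr_sumr; apply: normc_sum => i ir.
rewrite mulrCA ComplexField.Normc.normcM normc_real gtr0_norm ?w0//.
by rewrite ler_wpM2l ?(ltW (w0 ir))// normc_div_1DM_le// tau0.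
Qed.

(** One [W] bounds sqrt B - 1. The other bounds s B', whose modes are w times -(tau s / (1 + tau s))
    / (1 + tau s), both factors being at most 1 in modulus; dividing by 2 sqrt B does no harm. *)
Lemma normc_dattenuation_le : normc (dattenuation s) <= W + W.
Proof.
apply: le_trans (le_normcD _ _) _; apply: lerD.
  rewrite -[X in normc X]mul1r; apply: normc_mul_sqrtc_complianceB1_le; rewrite mul1r.
  apply: normc_sum => i ir.
  rewrite ComplexField.Normc.normcM normc_real gtr0_norm ?w0//.
  by rewrite ler_piMr ?(ltW (w0 ir))// normc_1DMV_le1// tau0.
rewrite mulrA ComplexField.Normc.normcM -[leRHS]mulr1; apply: ler_pM; rewrite ?normc_ge0//.
  rewrite mulr_sumr; apply: normc_sum => i ir.
  rewrite (_ : s * _ = (w i)%:C * (- (tau i)%:C *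
     ((s / (1 + (tau i)%:C * s)) * (1 + (tau i)%:C * s)^-1))); last by ring.
  rewrite ComplexField.Normc.normcM normc_real gtr0_norm ?w0//.
  rewrite ler_piMr ?(ltW (w0 ir))// mulNr normcN ComplexField.Normc.normcM.
  rewrite normc_real gtr0_norm ?tau0// mulrC -ler_pdivlMr ?tau0// div1r.
  rewrite ComplexField.Normc.normcM -[leRHS]mulr1 ler_pM ?normc_ge0//.
    by rewrite normc_div_1DM_le// tau0.
  by rewrite normc_1DMV_le1// tau0.
rewrite ComplexField.Normc.normcV invf_le1; last first.
  rewrite lt_def normc_ge0 andbT; apply/eqP => /ComplexField.Normc.eq0_normc/eqP.
  by rewrite mulf_eq0 pnatr_eq0/= (negbTE sqrtc_compliance_neq0).
rewrite ComplexField.Normc.normcM -[leLHS]mulr1 ler_pM// ?normc_sqrtc_compliance_ge1//.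
by rewrite -[2]/(2%:R) -(rmorph_nat (real_complex R)) normc_real ger0_norm// ler1n.
Qed.

Lemma cderive_compliance : cderive compliance s (dcompliance s).
Proof.
rewrite -[X in cderive _ _ X]add0r; apply: cderiveD; first exact: cderive_cst.
apply: cderive_sum => i ir; apply: cderiveZ; apply: cderive_1DMV => //.
exact: tau0.
Qed.

Lemma cderive_sqrtc_compliance : cderive (fun z => sqrtc (compliance z)) s
  (dcompliance s / (2 * sqrtc (compliance s))).
Proof.
apply: cderive_sqrtc; last exact: cderive_compliance.
exact: lt_le_trans ltr01 Re_compliance_ge1.
Qed.

Lemma cderive_attenuation : cderive attenuation s (dattenuation s).
Proof.
rewrite /dattenuation -[X in X + s * _]mul1r -[X in s * X]addr0.
apply: cderiveM; first exact: cderive_id.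
by apply: cderiveD; [exact: cderive_sqrtc_compliance|exact: cderive_cst].
Qed.

(** The value is left open: a second derivative serves only to make the first one continuous along
    vertical lines. *)
Lemma cderive_dattenuation : exists d, cderive dattenuation s d.
Proof.
eexists; apply: cderiveD.
  by apply: cderiveD; [exact: cderive_sqrtc_compliance|exact: cderive_cst].
apply: cderiveM; first exact: cderive_id.
apply: cderiveM; last first.
  apply: cderiveV; last by apply: cderiveZ; exact: cderive_sqrtc_compliance.
  by rewrite mulf_neq0 ?pnatr_eq0// sqrtc_compliance_neq0.
apply: cderive_sum => i ir; apply: cderiveZ; apply: cderiveZ.
by apply: cderiveM; apply: cderive_1DMV => //; exact: tau0.
Qed.

End at_s.

(** * The regularised kernel and its line integral *)

Section kernel.
Variables (t L : R).
Hypotheses (t0 : t < 0) (L0 : 0 <= L).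

(** At s = -i u and L = |x| / c0 this is exp (-i u t) times the transformed kernel, divided by (1 -
    i u)^2. *)
Definition kernel_transform (s : C) : C :=
  cexp (t%:C * s - L%:C * attenuation s) * ((1 + s)^-1 * (1 + s)^-1).

Definition dkernel_transform (s : C) : C :=
  kernel_transform s * (t%:C - L%:C * dattenuation s - 2 * (1 + s)^-1).

(** exp (L T) bounds |exp (- L E)|, and - t + L (W + W) + 2 the logarithmic derivative. The extra 1
    makes [bound] at least exp (L T), so that one constant serves the function and its
    derivative. *)
Let bound := expR (L * T) * (1 - t + L * (W + W) + 2).

Lemma cderive_1DV s : 0 <= Re s ->
  cderive (fun z => (1 + z)^-1) s (- (1 + s)^-1 ^+ 2).
Proof.
move=> s0; have := cderive_1DMV ltr01 s0.
rewrite mulN1r mul1r (_ : (fun z => _) = fun z => (1 + z)^-1)//.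
by apply/funext => z; rewrite mul1r.
Qed.

Lemma cderive_kernel_transform s : 0 <= Re s ->
  cderive kernel_transform s (dkernel_transform s).
Proof.
move=> s0; have d1 := cderive_1DV s0.
have dE := cderiveZ (- L%:C) (cderive_attenuation s0).
have d := cderiveM (cderive_exp (cderiveD (cderiveZ t%:C (@cderive_id _ s)) dE))
  (cderiveM d1 d1).
rewrite (_ : kernel_transform = fun z => cexp (t%:C * z + - L%:C * attenuation z) *
  ((1 + z)^-1 * (1 + z)^-1)); last first.
  by apply/funext => z; rewrite /kernel_transform mulNr.
apply: (cderive_eq d).
by rewrite /dkernel_transform /kernel_transform mulNr; ring.
Qed.

Lemma cderive_dkernel_transform s : 0 <= Re s ->
  exists d, cderive dkernel_transform s d.
Proof.
move=> s0; have [d dd] := cderive_dattenuation s0.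
have dk := cderiveM (cderive_kernel_transform s0) (cderiveD (cderiveD
  (@cderive_cst _ t%:C s) (cderiveZ (- L%:C) dd)) (cderiveZ (- 2) (cderive_1DV s0))).
eexists; rewrite (_ : dkernel_transform = fun z => kernel_transform z *
  (t%:C + - L%:C * dattenuation z + - 2 * (1 + z)^-1)); first exact: dk.
by apply/funext => z; rewrite /dkernel_transform !mulNr.
Qed.

(** |1 + s|^2 = (1 + Re s)^2 + (Im s)^2, and 1 + Re s >= 1. *)
Lemma normc_1DV_sqr_le s : 0 <= Re s ->
  normc ((1 + s)^-1 * (1 + s)^-1) <= (oneDsqr (Im s))^-1.
Proof.
move=> s0; rewrite -expr2 exprVn ComplexField.Normc.normcV.
rewrite lef_pV2 ?posrE; last 2 first.
- rewrite expr2 ComplexField.Normc.normcM -expr2 sqr_normc_parts !cpartE /=.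
  by rewrite ltr_pwDl ?sqr_ge0// exprn_gt0// ltr_pwDl.
- exact: lt_le_trans ltr01 (oneDsqr_ge1 _).
rewrite expr2 ComplexField.Normc.normcM -expr2 sqr_normc_parts !cpartE /= add0r.
rewrite /oneDsqr lerD2r; nra.
Qed.

Lemma normc_kernel_transform_le s : 0 <= Re s ->
  normc (kernel_transform s) <=
  expR (t * Re s) * (expR (L * T) * (oneDsqr (Im s))^-1).
Proof.
move=> s0; rewrite ComplexField.Normc.normcM normc_cexp mulrA -expRD.
apply: ler_pM; rewrite ?expR_ge0 ?normc_ge0 ?normc_1DV_sqr_le//.
move: (attenuation s) (normc_attenuation_le s0) => e eT.
rewrite ler_expR !cpartE /= !mul0r !subr0 lerD2l -mulrN ler_wpM2l//.
rewrite -Re_opp; apply: le_trans eT.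
by rewrite -[leRHS]normcN; exact: Re_le_normc.
Qed.

Lemma normc_kernel_transform_le_neg s : 0 <= Re s ->
  normc (kernel_transform s) <= expR (L * T) * (oneDsqr (Im s))^-1.
Proof.
move=> s0; apply: le_trans (normc_kernel_transform_le s0) _.
rewrite ler_piMl ?mulr_ge0 ?expR_ge0// ?invr_ge0 ?(le_trans ler01 (oneDsqr_ge1 _))//.
by rewrite -expR0 ler_expR mulr_le0_ge0// ltW.
Qed.

Let W0 : 0 <= W.
Proof. by rewrite /W big_seq; apply: sumr_ge0 => i ir; exact/ltW/w0. Qed.

Lemma normc_dkernel_transform_le s : 0 <= Re s ->
  normc (dkernel_transform s) <= bound * (oneDsqr (Im s))^-1.
Proof.
move=> s0; rewrite ComplexField.Normc.normcM /bound mulrAC.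
apply: ler_pM; rewrite ?normc_ge0 ?normc_kernel_transform_le_neg//.
apply: le_trans (le_normcD _ _) _; apply: lerD; last first.
  rewrite normcN ComplexField.Normc.normcM -(rmorph_nat (real_complex R)) normc_real.
  rewrite ger0_norm// ler_piMr//.
  by have := normc_1DMV_le1 ltr01 s0; rewrite mul1r.
apply: le_trans (le_normcD _ _) _; apply: lerD.
  by rewrite normc_real ltr0_norm// lerDr.
rewrite normcN ComplexField.Normc.normcM normc_real ger0_norm// ler_wpM2l//.
exact: normc_dattenuation_le.
Qed.

Lemma curve_derive_kernel_transform (y u : R) : 0 <= y ->
  curve_derive (fun x => kernel_transform (y -i* x)) u
    (dkernel_transform (y -i* u) * - 'i).
Proof.
move=> y0; apply: cderive_kernel_transform => //.
by split; rewrite /= ?oppr0; [exact: is_derive_cst|exact: is_deriveNid].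
Qed.

Lemma kernel_transform_continuous (y : R) : 0 <= y ->
  continuous (fun u => Re (kernel_transform (y -i* u))) /\
  continuous (fun u => Im (kernel_transform (y -i* u))).
Proof.
move=> y0; apply: (@curve_derive_continuous R (fun u => kernel_transform (y -i* u))) => u.
by eexists; exact: curve_derive_kernel_transform.
Qed.

(** Write F for the transform. Along y - i u its y-derivative is F' and its u-derivative is -i F'.
    Hence Re F' is the u-derivative of - Im F, and Im F' that of Re F: these are the two triples fed
    to [half_plane_Rintegral_eq0]. *)
Lemma cintegral_kernel_transform :
  cintegral (fun u => kernel_transform (0 -i* u)) = 0.
Proof.
pose p (y u : R) : C := y -i* u.
have py u : forall y, curve_derive (p ^~ u) y 1.
  by move=> y; split; [exact: is_derive_id|exact: is_derive_cst].
have pu y : forall u, curve_derive (p y) u (- 'i).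
  move=> u; split; rewrite /= ?oppr0; first exact: is_derive_cst.
  exact: is_deriveNid.
have Fy y u : 0 <= y ->
    curve_derive (fun x => kernel_transform (p x u)) y (dkernel_transform (p y u)).
  move=> y0; rewrite -[X in curve_derive _ _ X]mulr1.
  exact: cderive_kernel_transform (py u y).
have Fu y u : 0 <= y -> curve_derive (fun x => kernel_transform (p y x)) u
    (dkernel_transform (p y u) * - 'i).
  exact: curve_derive_kernel_transform.
have cF1 (y : R) : 0 <= y -> continuous (fun u => Re (kernel_transform (p y u))).
  by move=> /kernel_transform_continuous[].
have cF2 (y : R) : 0 <= y -> continuous (fun u => Im (kernel_transform (p y u))).
  by move=> /kernel_transform_continuous[].
have dFu y u : 0 <= y -> exists d, curve_derive (fun x => dkernel_transform (p y x)) u d.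
  move=> y0; have [d dd] := @cderive_dkernel_transform (p y u) y0.
  by eexists; exact: dd (pu y u).
have [cD1 cD2] :
    (forall y : R, 0 <= y -> continuous (fun u => Re (dkernel_transform (p y u)))) /\
    (forall y : R, 0 <= y -> continuous (fun u => Im (dkernel_transform (p y u)))).
  by split => y y0; have [] := @curve_derive_continuous R
    (fun u => dkernel_transform (p y u)) (fun u => dFu y u y0).
have ImE y u : oneDsqr (Im (p y u)) = oneDsqr u by rewrite /oneDsqr /= sqrrN.
have le_bound : expR (L * T) <= bound.
  rewrite /bound ler_peMr ?expR_ge0// -!addrA lerDl.
  by rewrite !addr_ge0// ?oppr_ge0 ?(ltW t0)// mulr_ge0// addr_ge0.
have bF y u : 0 <= y ->
    normc (kernel_transform (p y u)) <= expR (t * y) * (bound * (oneDsqr u)^-1).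
  move=> y0; apply: le_trans (@normc_kernel_transform_le (p y u) y0) _.
  by rewrite ImE ler_wpM2l ?expR_ge0// ler_wpM2r.
have bF' y u : 0 <= y -> normc (kernel_transform (p y u)) <= bound * (oneDsqr u)^-1.
  move=> y0; apply: le_trans (@normc_kernel_transform_le_neg (p y u) y0) _.
  by rewrite ImE ler_wpM2r.
have bD y u : 0 <= y -> normc (dkernel_transform (p y u)) <= bound * (oneDsqr u)^-1.
  by move=> y0; apply: le_trans (@normc_dkernel_transform_le (p y u) y0) _; rewrite ImE.
apply: complexP => /=.
- apply: (@half_plane_Rintegral_eq0 R (fun y u => Re (kernel_transform (p y u)))
    (fun y u => - Im (kernel_transform (p y u)))
    (fun y u => Re (dkernel_transform (p y u))) bound t) => //.
  + by move=> y u /Fy => /(_ u) [].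
  + move=> y u /(Fu _ u) [_ h].
    apply: (is_derive_eq (is_deriveN h)).
    by move: (dkernel_transform _) => D; rewrite !cpartE /=; ring.
  + by move=> y u y0; apply: le_trans (norm_Re_le_normc _) _; exact: bF.
  + by move=> y u y0; rewrite normrN; apply: le_trans (norm_Im_le_normc _) _; exact: bF'.
  + by move=> y u y0; apply: le_trans (norm_Re_le_normc _) _; exact: bD.
- apply: (@half_plane_Rintegral_eq0 R (fun y u => Im (kernel_transform (p y u)))
    (fun y u => Re (kernel_transform (p y u)))
    (fun y u => Im (dkernel_transform (p y u))) bound t) => //.
  + by move=> y u /Fy => /(_ u) [].
  + move=> y u /(Fu _ u) [h _].
    apply: (is_derive_eq h).
    by move: (dkernel_transform _) => D; rewrite !cpartE /=; ring.
  + by move=> y u y0; apply: le_trans (norm_Im_le_normc _) _; exact: bF.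
  + by move=> y u y0; apply: le_trans (norm_Re_le_normc _) _; exact: bF'.
  + by move=> y u y0; apply: le_trans (norm_Im_le_normc _) _; exact: bD.
Qed.
End kernel.
End relaxation.

(** * Fourier integrals of test functions *)

Section fourier.
Variable R : realType.
Local Notation C := R[i].
Local Notation Re := (@complex.Re R).
Local Notation Im := (@complex.Im R).
Local Notation normc := (@ComplexField.Normc.normc R).
Local Notation mu := (@lebesgue_measure R).

(** The product majorant gives integrability on the plane and on every slice, so that no inner
    [fine] meets an infinite value. *)
Lemma Rintegral_swap (F : R -> R -> R) (p q : R -> R) :
  measurable_fun setT (fun z : R * R => F z.1 z.2) ->
  mu.-integrable setT (EFin \o p) -> mu.-integrable setT (EFin \o q) ->
  (forall x y, `|F x y| <= p x * q y) ->
  \int[mu]_x \int[mu]_y F x y = \int[mu]_y \int[mu]_x F x y.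
Proof.
move=> mF ip iq bF.
pose f (z : R * R) : \bar R := (F z.1 z.2)%:E.
have mf : measurable_fun setT f by exact/measurable_EFinP.
have mF1 x : measurable_fun setT (F x).
  exact: (measurableT_comp mF (pair1_measurable x)).
have mF2 y : measurable_fun setT (F ^~ y).
  exact: (measurableT_comp mF (pair2_measurable y)).
have i1 x : mu.-integrable setT (EFin \o F x).
  apply: (@dominated_integrable _ _ (fun y => p x * q y)) => //.
  exact: (integrableZl measurableT (p x) iq).
have i2 y : mu.-integrable setT (EFin \o F ^~ y).
  apply: (@dominated_integrable _ _ (fun x => p x * q y)) => //.
  exact: (integrableZr measurableT (q y) ip).
have intf : (mu \x mu)%E.-integrable setT f.
  apply/integrable12ltyP => //.
  (* No sign is assumed for [p] and [q] separately, hence the absolute values. *)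
  apply: (@le_lt_trans _ _ (\int[mu]_x (`|p x| * \int[mu]_y `|q y|)%:E)%E).
    apply: ge0_le_integral => //.
    - by move=> x _; apply: integral_ge0.
    - have maf : measurable_fun setT (abse \o f) by exact: measurableT_comp.
      exact: (@measurable_fun_fubini_tonelli_F _ _ _ _ _ mu _ maf (fun z => abse_ge0 (f z))).
    - have /integrableP[/measurable_EFinP mp _] := ip.
      apply/measurable_EFinP/measurable_funM => //.
      exact: measurableT_comp.
    - move=> x _ /=.
      rewrite EFinM.
      have iqn := integrable_norm iq.
      rewrite [X in (_ * X)%E](_ : _ = \int[mu]_y (`|q y|)%:E)%E; last first.
        by rewrite /Rintegral fineK//; exact: integrable_fin_num.
      rewrite -ge0_integralZl//; last by have /integrableP[] := iqn.
      apply: ge0_le_integral => //.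
      - by apply/measurable_EFinP/measurableT_comp => //; exact: mF1.
      - apply: emeasurable_funM => //.
        by have /integrableP[] := iqn.
      - move=> y _; rewrite lee_fin (le_trans (bF x y))//.
        by rewrite -normrM ler_norm.
  have ipn := integrable_norm ip.
  have /integrableP[_] := integrableZr measurableT (\int[mu]_y `|q y|) ipn.
  apply: le_lt_trans; apply: ge0_le_integral => //.
  - by move=> x _; rewrite lee_fin mulr_ge0// Rintegral_ge0.
  - have /integrableP[/measurable_EFinP mp _] := ip.
    apply/measurable_EFinP/measurable_funM => //.
    exact: measurableT_comp.
  - apply: measurableT_comp => //; apply: emeasurable_funM => //.
    by have /integrableP[] := ipn.
  - by move=> x _; exact: lee_abs.
have := Fubini intf.
rewrite /Rintegral => E; congr fine.
transitivity (\int[mu]_x \int[mu]_y f (x, y))%E.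
  apply: eq_integral => x _.
  by rewrite fineK//; exact: integrable_fin_num (i1 x).
rewrite E; apply: eq_integral => y _.
by rewrite fineK//; exact: integrable_fin_num (i2 y).
Qed.

Lemma cintegral_swap (f : R -> R -> C) (p q : R -> R) :
  measurable_fun setT (fun z : R * R => Re (f z.1 z.2)) ->
  measurable_fun setT (fun z : R * R => Im (f z.1 z.2)) ->
  mu.-integrable setT (EFin \o p) -> mu.-integrable setT (EFin \o q) ->
  (forall x y, normc (f x y) <= p x * q y) ->
  cintegral (fun x => cintegral (f x)) = cintegral (fun y => cintegral (f ^~ y)).
Proof.
move=> mr mi ip iq bf; apply: complexP => /=; apply: (Rintegral_swap (p := p) (q := q)) => //.
  by move=> x y; exact: le_trans (norm_Re_le_normc _) (bf x y).
by move=> x y; exact: le_trans (norm_Im_le_normc _) (bf x y).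
Qed.

Lemma cintegralZl (c : C) (f : R -> C) :
  mu.-integrable setT (EFin \o (fun t => Re (f t))) ->
  mu.-integrable setT (EFin \o (fun t => Im (f t))) ->
  cintegral (fun t => c * f t) = c * cintegral f.
Proof.
move=> i1 i2.
have Z (k : R) g : mu.-integrable setT (EFin \o g) ->
  mu.-integrable setT (EFin \o (fun t => k * g t)).
  by move=> ig; exact: (integrableZl measurableT k ig).
apply: complexP; rewrite cpartE /=.
  rewrite -!RintegralZl// -RintegralB ?Z//.
  by apply: eq_Rintegral => t _; rewrite cpartE.
rewrite -!RintegralZl// -RintegralD ?Z//.
by apply: eq_Rintegral => t _; rewrite cpartE.
Qed.

Lemma cintegralB (f g : R -> C) :
  mu.-integrable setT (EFin \o (fun t => Re (f t))) ->
  mu.-integrable setT (EFin \o (fun t => Im (f t))) ->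
  mu.-integrable setT (EFin \o (fun t => Re (g t))) ->
  mu.-integrable setT (EFin \o (fun t => Im (g t))) ->
  cintegral (fun t => f t - g t) = cintegral f - cintegral g.
Proof.
move=> i1 i2 i3 i4; apply: complexP; rewrite !cpartE /= -RintegralB//;
by apply: eq_Rintegral => t _; rewrite !cpartE.
Qed.

Lemma integrable_compact_support (h : R -> R) (a b : R) : continuous h ->
  (forall t, t < a \/ b < t -> h t = 0) -> mu.-integrable setT (EFin \o h).
Proof.
move=> ch h0.
have -> : EFin \o h = (EFin \o h) \_ `[a, b]%classic.
  apply/funext => t; rewrite patchE; case: ifPn => //.
  rewrite notin_setE /= in_itv /= => /negP; rewrite negb_and -!ltNge => /orP tab.
  by rewrite /= h0.
apply/integrable_restrict => //; rewrite setTI.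
apply: continuous_compact_integrable; first exact: segment_compact.
exact: continuous_subspaceT.
Qed.

Lemma Rintegral_derive_compact_support (g h : R -> R) (a b : R) :
  (forall t : R, is_derive t (1 : R) g (h t)) -> continuous h ->
  (forall t, t < a \/ b < t -> g t = 0) ->
  (forall t, t < a \/ b < t -> h t = 0) -> \int[mu]_t h t = 0.
Proof.
move=> dg ch g0 h0.
apply: (@Rintegral_derive_eq0 _ g h (fun t => `|h t|)) => //.
- exact/integrable_norm/(integrable_compact_support ch h0).
- apply: cvg_near_cst; near=> n; apply: g0; right.
  by near: n; exact: nbhs_infty_gtr.
- apply: cvg_near_cst; near=> n; apply: g0; left; rewrite ltrNl.
  by near: n; exact: nbhs_infty_gtr.
Unshelve. all: by end_near. Qed.

(** The complement of [a, b] is open, so [g] vanishes near each of its points. *)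
Lemma derive_support (g h : R -> R) (a b : R) :
  (forall t : R, is_derive t (1 : R) g (h t)) ->
  (forall t, t < a \/ b < t -> g t = 0) ->
  forall t, t < a \/ b < t -> h t = 0.
Proof.
move=> dg g0 t tab; have [_ <-] := dg t.
suff : is_derive t (1 : R) g 0 by case.
apply: near_eq_is_derive (is_derive_cst (0 : R) t (1 : R)).
case: tab => ta.
  by near=> x; rewrite [RHS]g0//; left; near: x; exact: lt_nbhsl.
by near=> x; rewrite [RHS]g0//; right; near: x; exact: lt_nbhsr.
Unshelve. all: by end_near. Qed.

Definition fourier_char (w t : R) : C := cexp (- ((w * t)%:C * 'i)).

Lemma fourier_charE w t : fourier_char w t = cos (w * t) -i* sin (w * t).
Proof.
rewrite /fourier_char /cexp !cpartE /= !mul0r !mulr0 !mulr1 subr0 oppr0 expR0 addr0.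
by rewrite cosN sinN mul1r.
Qed.

Lemma normc_fourier_char w t : normc (fourier_char w t) = 1.
Proof.
by rewrite normc_cexp !cpartE /= !mul0r !mulr0 subrr oppr0 expR0.
Qed.

Lemma curve_derive_fourier_char w t :
  curve_derive (fourier_char w) t (- (w%:C * 'i) * fourier_char w t).
Proof.
have h : curve_derive (fun x => - ((w * x)%:C * 'i)) t (- (w%:C * 'i)).
  split; rewrite !cpartE /=.
    rewrite (_ : (fun x => _) = cst 0).
      by apply: (is_derive_eq (is_derive_cst _ _ _)); ring.
    by apply/funext => x; rewrite ?cpartE /=; ring.
  rewrite (_ : (fun x => _) = (- w) \*: id).
    apply: (is_derive_eq (is_deriveZ (- w) (is_derive_id t 1))).
    by rewrite /GRing.scale /=; ring.
  by apply/funext => x; rewrite ?cpartE /= /GRing.scale /=; ring.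
by rewrite mulrC; exact: curve_derive_exp h.
Qed.

Lemma curve_derive_real (g : R -> R) t d :
  is_derive t (1 : R) g d -> curve_derive (fun x => (g x)%:C) t d%:C.
Proof. by move=> dg; split => //=; exact: is_derive_cst. Qed.

(** This is [inv_fourier_test] without the factor 1 / sqrt (2 pi). *)
Definition fourier_integral (phi : R -> R) (w : R) : C :=
  cintegral (fun t => fourier_char w t * (phi t)%:C).

Lemma continuous_fourier_char w :
  continuous (fun t => Re (fourier_char w t)) /\
  continuous (fun t => Im (fourier_char w t)).
Proof.
by apply: curve_derive_continuous => t; eexists; exact: curve_derive_fourier_char.
Qed.

Lemma fourier_integrand_continuous (phi : R -> R) w : continuous phi ->
  continuous (fun t => Re (fourier_char w t * (phi t)%:C)) /\
  continuous (fun t => Im (fourier_char w t * (phi t)%:C)).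
Proof.
move=> cphi; have [c1 c2] := continuous_fourier_char w; split.
  rewrite (_ : (fun t => _) = fun t => Re (fourier_char w t) * phi t).
    by move=> t; apply: cvgM; [exact: c1|exact: cphi].
  by apply/funext => t; rewrite cpartE Re_of_real Im_of_real mulr0 subr0.
rewrite (_ : (fun t => _) = fun t => Im (fourier_char w t) * phi t).
  by move=> t; apply: cvgM; [exact: c2|exact: cphi].
by apply/funext => t; rewrite cpartE Re_of_real Im_of_real mulr0 add0r.
Qed.

Lemma fourier_integrand_integrable (phi : R -> R) a b w : continuous phi ->
  (forall t, t < a \/ b < t -> phi t = 0) ->
  mu.-integrable setT (EFin \o (fun t => Re (fourier_char w t * (phi t)%:C))) /\
  mu.-integrable setT (EFin \o (fun t => Im (fourier_char w t * (phi t)%:C))).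
Proof.
move=> cphi phi0; have [c1 c2] := fourier_integrand_continuous w cphi.
split; apply: (@integrable_compact_support _ a b) => // t /phi0 ->;
by rewrite mulr0.
Qed.

(** Integration by parts: 1 - d/dt becomes multiplication by 1 - i w, which is 1 + s at s = -i w. *)
Lemma fourier_integralB_derive (phi dphi : R -> R) a b w :
  (forall t : R, is_derive t (1 : R) phi (dphi t)) -> continuous dphi ->
  (forall t, t < a \/ b < t -> phi t = 0) ->
  fourier_integral (fun t => phi t - dphi t) w =
  (1 - w%:C * 'i) * fourier_integral phi w.
Proof.
move=> dp cd p0.
have cp : continuous phi.
  by move=> t; apply/differentiable_continuous/derivable1_diffP; have [] := dp t.
have d0 := derive_support dp p0.
have [i1 i2] := fourier_integrand_integrable w cp p0.
have c0 : continuous (fun t => phi t - dphi t).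
  by move=> t; apply: cvgB; [exact: cp|exact: cd].
have s0 t : t < a \/ b < t -> phi t - dphi t = 0 by move=> tab; rewrite p0// d0// subrr.
have [i3 i4] := fourier_integrand_integrable w c0 s0.
rewrite /fourier_integral -cintegralZl//; apply/eqP; rewrite eq_sym -subr_eq0.
have Zi (f : R -> C) (c : C) : 
  mu.-integrable setT (EFin \o (fun t => Re (f t))) ->
  mu.-integrable setT (EFin \o (fun t => Im (f t))) ->
  mu.-integrable setT (EFin \o (fun t => Re (c * f t))) /\
  mu.-integrable setT (EFin \o (fun t => Im (c * f t))).
  move=> j1 j2; split.
    rewrite (_ : _ \o _ = (fun t => (Re c)%:E * (Re (f t))%:E - (Im c)%:E * (Im (f t))%:E)%E).
      by apply: integrableB => //; apply: integrableZl.
    by apply/funext => t; rewrite /= cpartE.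
  rewrite (_ : _ \o _ = (fun t => (Re c)%:E * (Im (f t))%:E + (Im c)%:E * (Re (f t))%:E)%E).
    by apply: integrableD => //; apply: integrableZl.
  by apply/funext => t; rewrite /= cpartE.
have [i5 i6] := Zi _ (1 - w%:C * 'i) i1 i2.
rewrite -cintegralB//; apply/eqP.
pose g t := fourier_char w t * (phi t)%:C.
pose h t := - (w%:C * 'i) * fourier_char w t * (phi t)%:C + fourier_char w t * (dphi t)%:C.
have dg t : curve_derive g t (h t).
  by apply: curve_deriveM; [exact: curve_derive_fourier_char|exact: curve_derive_real].
(* The difference of the two integrands is the exact derivative of character times [phi]. *)
have hE : (fun t => (1 - w%:C * 'i) * (fourier_char w t * (phi t)%:C) -
    fourier_char w t * (phi t - dphi t)%:C) = h.
  by apply/funext => t; rewrite /h rmorphB; ring.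
have [c1 c2] := fourier_integrand_continuous w cp.
have [c3 c4] := fourier_integrand_continuous w cd.
have ch1 : continuous (fun t => Re (h t)).
  rewrite (_ : (fun t => _) = fun t => w * Im (fourier_char w t * (phi t)%:C) +
      Re (fourier_char w t * (dphi t)%:C)).
    by move=> t; apply: cvgD; [apply: cvgM; [exact: cvg_cst|exact: c2]|exact: c3].
  by apply/funext => t; rewrite /h; move: (fourier_char w t) => e; rewrite !cpartE /=; ring.
have ch2 : continuous (fun t => Im (h t)).
  rewrite (_ : (fun t => _) = fun t => - w * Re (fourier_char w t * (phi t)%:C) +
      Im (fourier_char w t * (dphi t)%:C)).
    by move=> t; apply: cvgD; [apply: cvgM; [exact: cvg_cst|exact: c1]|exact: c4].
  by apply/funext => t; rewrite /h; move: (fourier_char w t) => e; rewrite !cpartE /=; ring.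
have g0 t : t < a \/ b < t -> g t = 0 by move=> /p0; rewrite /g => ->; rewrite mulr0.
have h0 t : t < a \/ b < t -> h t = 0.
  by move=> tab; rewrite /h p0// d0// !mulr0 addr0.
rewrite hE; apply: complexP.
  apply: (@Rintegral_derive_compact_support (fun t => Re (g t)) (fun t => Re (h t)) a b) => //.
  - by move=> t; have [] := dg t.
  - by move=> t tab; rewrite g0.
  - by move=> t tab; rewrite h0.
apply: (@Rintegral_derive_compact_support (fun t => Im (g t)) (fun t => Im (h t)) a b) => //.
- by move=> t; have [] := dg t.
- by move=> t tab; rewrite g0.
- by move=> t tab; rewrite h0.
Qed.
End fourier.

(** * The Nachman-Smith-Waag kernel *)

Section nsw.
Variable R : realType.
Local Notation C := R[i].
Local Notation Re := (@complex.Re R).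
Local Notation Im := (@complex.Im R).
Local Notation normc := (@ComplexField.Normc.normc R).
Local Notation mu := (@lebesgue_measure R).

(** The two roots of [z] differ by sign, and a positive real part excludes the minus sign. *)
Lemma sqrtc_eq (v z : C) : 0 < Re v -> v ^+ 2 = z -> sqrtc z = v.
Proof.
move=> v0 vz; have : sqrtc z ^+ 2 == v ^+ 2 by rewrite sqr_sqrtc vz.
rewrite eqf_sqr => /orP[/eqP//|/eqP e].
have : 0 <= Re (sqrtc z) by case: (z) => a b; rewrite /= sqrtr_ge0.
by rewrite e Re_opp oppr_ge0 leNgt v0.
Qed.

(** The relation between [a] and [a'] says e (1 + a' s) = (e - w) (1 + a s) + w; it is the one
    satisfied by tau and tautilde. *)
Lemma relaxation_partial_fraction (e w a a' : R) (s : C) :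
  1 + a%:C * s != 0 -> e * a' = a * (e - w) ->
  e%:C * ((1 + a'%:C * s) / (1 + a%:C * s)) =
  (e - w)%:C + w%:C * (1 + a%:C * s)^-1.
Proof.
move=> q0 ea; rewrite mulrA; apply: (canLR (mulfK q0)).
rewrite mulrDl mulfVK// mulrDr mulr1 mulrA -rmorphM ea rmorphM rmorphB; ring.
Qed.

Variables (N : nat) (c0 rho0 : R) (kappa tau : nat -> R).
Hypotheses (N0 : (0 < N)%N) (c00 : 0 < c0) (rho00 : 0 < rho0).
Hypothesis pos : forall m : nat, (1 <= m <= N)%N -> 0 < kappa m /\ 0 < tau m.

Let w m := c0 ^+ 2 * rho0 * kappa m.
Let modes := index_iota 1 N.+1.

Let w0 m : m \in modes -> 0 < w m.
Proof.
rewrite mem_index_iota => /pos[k0 _].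
by rewrite /w !mulr_gt0// exprn_gt0.
Qed.

Let tau0 m : m \in modes -> 0 < tau m.
Proof. by rewrite mem_index_iota => /pos[]. Qed.

(** (c0 / ctilde0)^2 = 1 + A with A the sum of the [w m]. Pulled under the root, this factor turns
    the mean of the quotients into B. *)
Lemma csqrt_compliance (u : R) :
  (c0 / ctilde0 N c0 rho0 kappa)%:C *
     csqrt ((N%:R)^-1%:C *
        \sum_(1 <= m < N.+1)
          ((1 - (tautilde N c0 rho0 kappa tau m * u)%:C * 'i) /
           (1 - (tau m * u)%:C * 'i))) =
  sqrtc (compliance modes w tau (0 -i* u)).
Proof.
pose s : C := 0 -i* u.
have s0 : 0 <= Re s by [].
have sE (x : R) : 1 - (x * u)%:C * 'i = 1 + x%:C * s.
  by apply: complexP; rewrite !cpartE /=; ring.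
set S := _ * \sum_(_ <= _ < _) _.
pose A := \sum_(1 <= m < N.+1) w m.
have A0 : 0 <= A by rewrite /A big_seq; apply: sumr_ge0 => m /w0/ltW.
have D0 : 0 < 1 + A by rewrite ltr_pwDl.
have sD0 : 0 < Num.sqrt (1 + A) by rewrite sqrtr_gt0.
have kE : c0 / ctilde0 N c0 rho0 kappa = Num.sqrt (1 + A).
  by rewrite /ctilde0 -/A; field; rewrite !lt0r_neq0.
have SE : (1 + A)%:C * S = compliance modes w tau s.
  (* The weight of each quotient once 1 + A is absorbed; then tautilde = tau (1 - w / e). *)
  pose e := (1 + A) / N%:R.
  have n0 : N%:R != 0 :> R by rewrite pnatr_eq0 -lt0n.
  have et m : e * tautilde N c0 rho0 kappa tau m = tau m * (e - w m).
    rewrite /tautilde /ctilde0 -/A exprMn exprVn sqr_sqrtr ?(ltW D0)// /e /w.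
    by field; rewrite n0 lt0r_neq0.
  rewrite /S mulrA -rmorphM -/e mulr_sumr.
  under eq_big_nat => m mN.
    have q0 : 1 + (tau m)%:C * s != 0 by apply: neq0_1DM => //; have [] := pos mN.
    rewrite !sE (relaxation_partial_fraction q0 (et m)).
    over.
  (* The constants e - w m add up to (1 + A) - A = 1, the leading term of B. *)
  rewrite big_split /= -rmorph_sum sumrB sumr_const_nat subn1 /=.
  by rewrite -/A /e -[_ *+ N]mulr_natr divfK// addrK.
(* This puts the rescaled root in the open right half-plane, so that it is the principal root of
   B. *)
have ReS : 0 < Re S.
  have := Re_compliance_ge1 w0 tau0 s0; rewrite -SE Re_mul /= mul0r subr0 => h.
  by rewrite -(pmulr_rgt0 _ D0); exact: lt_le_trans h.
rewrite kE; apply/esym/sqrtc_eq.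
  by rewrite Re_mul /= mul0r subr0 mulr_gt0// Re_sqrtc_gt0.
by rewrite exprMn sqr_sqrtc -rmorphXn /= sqr_sqrtr ?(ltW D0).
Qed.

Lemma nsw_KhatE (x : 'rV[R]_3) (u : R) : nsw_Khat N c0 rho0 kappa tau x u =
  cexp (- ((eucl_norm3 x / c0)%:C * attenuation modes w tau (0 -i* u))).
Proof.
rewrite /nsw_Khat /alpha_nsw csqrt_compliance /attenuation; congr (cexp (- _)).
rewrite (_ : - (u%:C * 'i) = 0 -i* u); last by apply: complexP; rewrite !cpartE /=; ring.
by rewrite rmorphM fmorphV; ring.
Qed.

Lemma is_derive_derive1n (phi : R -> R) n (t : R) : smooth phi ->
  is_derive t (1 : R) (derive1n n phi) (derive1n n.+1 phi t).
Proof. by move=> sm; split; [exact: sm|rewrite derive1nS derive1E]. Qed.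

Lemma nsw_kernel_causal : causal_kernel (nsw_Khat N c0 rho0 kappa tau).
Proof.
move=> x phi [sm [a [b [b0 supp]]]].
pose f n := derive1n n phi.
have df n t : is_derive t (1 : R) (f n) (f n.+1 t) by exact: is_derive_derive1n.
have cf n : continuous (f n).
  by move=> t; apply/differentiable_continuous/derivable1_diffP; have [] := df n t.
have supp1 := derive_support (df 0%N) supp.
have supp2 := derive_support (df 1%N) supp1.
pose psi1 t := phi t - f 1%N t.
pose dpsi1 t := f 1%N t - f 2%N t.
pose psi t := psi1 t - dpsi1 t.
have dpsi1P t : is_derive t (1 : R) psi1 (dpsi1 t).
  exact: is_deriveB (df 0%N t) (df 1%N t).
have cdpsi1 : continuous dpsi1 by move=> t; apply: cvgB; exact: cf.
have cpsi : continuous psi.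
  by move=> t; apply: cvgB; [apply: cvgB; [exact: (cf 0%N)|exact: cf]|exact: cdpsi1].
have psi1_0 t : t < a \/ b < t -> psi1 t = 0.
  by move=> tab; rewrite /psi1 supp// supp1// subrr.
have psi0 t : t < a \/ b < t -> psi t = 0.
  by move=> tab; rewrite /psi psi1_0// /dpsi1 supp1// supp2// !subrr.
have FTE u :
    fourier_integral psi u = (1 - u%:C * 'i) * ((1 - u%:C * 'i) * fourier_integral phi u).
  rewrite -(fourier_integralB_derive u (df 0%N) (cf 1%N) supp).
  by rewrite -(fourier_integralB_derive u dpsi1P cdpsi1 psi1_0).
pose L := eucl_norm3 x / c0.
have L0 : 0 <= L by rewrite divr_ge0 ?sqrtr_ge0// ltW.
pose c : R := (Num.sqrt (2 * pi))^-1.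
pose K t u := kernel_transform modes w tau t L (0 -i* u).
have K0E t u : K t u = fourier_char u t * K 0 u.
  rewrite /K /kernel_transform mulrA -cexpD; congr (cexp _ * _).
  by apply: complexP; move: (attenuation _ _ _ _) => e; rewrite !cpartE /=; ring.
(* The pairing as a double integral in [u] and [t]: the factors (1 - i u)^2 produced by [psi] cancel
   the (1 + s)^-2 contained in [K 0]. *)
pose g u t := (c%:C * K 0 u) * (fourier_char u t * (psi t)%:C).
have gE u : nsw_Khat N c0 rho0 kappa tau x u * inv_fourier_test phi u = cintegral (g u).
  have [i1 i2] := fourier_integrand_integrable u cpsi psi0.
  rewrite /g cintegralZl// -/(fourier_integral psi u) FTE.
  rewrite /inv_fourier_test -/c -/(fourier_integral phi u) nsw_KhatE -/L.
  have v0 : 1 + (0 -i* u) != 0 :> C.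
    by have := @neq0_1DM R 1 (0 -i* u) ltr01 (lexx _); rewrite mul1r.
  rewrite (_ : 1 - u%:C * 'i = 1 + (0 -i* u)); last first.
    by apply: complexP; rewrite !cpartE /=; ring.
  rewrite /K /kernel_transform mul0r sub0r.
  by move: (cexp _) (fourier_integral _ _) v0 => E P v0; field.
pose M := expR (L * \sum_(i <- modes) w i / tau i).
(* On the imaginary axis exp (t s) has modulus 1, so the bound is uniform in [t]. *)
have bK t u : normc (K t u) <= M * (oneDsqr u)^-1.
  have := normc_kernel_transform_le w0 tau0 t L0 (s := 0 -i* u) (lexx _).
  rewrite /= mulr0 expR0 mul1r (_ : oneDsqr (- u) = oneDsqr u)//.
  by rewrite /oneDsqr sqrrN.
have iM k : mu.-integrable setT (EFin \o (fun u => k * (M * (oneDsqr u)^-1))).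
  rewrite (_ : _ \o _ = fun u => ((k * M)%:E * ((oneDsqr u)^-1)%:E)%E).
    exact: (integrableZl measurableT (k * M) (integrable_oneDsqrV R)).
  by apply/funext => u; rewrite /= mulrA.
have K_cont t : continuous (fun u => Re (K t u)) /\ continuous (fun u => Im (K t u)).
  exact: kernel_transform_continuous (lexx _).
have K_int t : mu.-integrable setT (EFin \o (fun u => Re (K t u))) /\
    mu.-integrable setT (EFin \o (fun u => Im (K t u))).
  have [k1 k2] := K_cont t.
  split; apply: (@dominated_integrable _ _ (fun u => 1 * (M * (oneDsqr u)^-1))) => //.
  - exact: continuous_measurable_fun.
  - by move=> u; rewrite mul1r (le_trans (norm_Re_le_normc _) (bK t u)).
  - exact: continuous_measurable_fun.
  - by move=> u; rewrite mul1r (le_trans (norm_Im_le_normc _) (bK t u)).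
(* For t >= 0 > b the function [psi] is zero at t; for t < 0 the line integral vanishes. *)
have g0 t : cintegral (g ^~ t) = 0.
  have [t0|t0] := ltP t 0; last first.
    have pt : psi t = 0 by apply: psi0; right; exact: lt_le_trans t0.
    rewrite (_ : (fun _ => _) = fun=> 0); last first.
      by apply/funext => u; rewrite /g pt !mulr0.
    by rewrite /cintegral /Rintegral /= integral0.
  rewrite (_ : (fun _ => _) = fun u => (c * psi t)%:C * K t u); last first.
    by apply/funext => u; rewrite /g (K0E t u) rmorphM; ring.
  have [k1 k2] := K_int t.
  by rewrite cintegralZl// (cintegral_kernel_transform w0 tau0 t0 L0) mulr0.
have [k1 k2] := K_cont 0.
have m1 : measurable_fun setT (fun z : R * R => Re (K 0 z.1)).
  by apply: (measurableT_comp (continuous_measurable_fun k1)).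
have m2 : measurable_fun setT (fun z : R * R => Im (K 0 z.1)).
  by apply: (measurableT_comp (continuous_measurable_fun k2)).
have m3 : measurable_fun setT (fun z : R * R => psi z.2).
  by apply: (measurableT_comp (continuous_measurable_fun cpsi)).
have mz : measurable_fun setT (fun z : R * R => z.1 * z.2) by exact: measurable_funM.
have m4 : measurable_fun setT (fun z : R * R => cos (z.1 * z.2)).
  by apply: (measurableT_comp (continuous_measurable_fun (@continuous_cos R)) mz).
have m5 : measurable_fun setT (fun z : R * R => sin (z.1 * z.2)).
  by apply: (measurableT_comp (continuous_measurable_fun (@continuous_sin R)) mz).
rewrite /kernel_pairing.
under eq_fun do rewrite gE.
(* After the exchange, the inner integral over [u] is 0 for every [t]. The majorant is a product of
   one integrable function of [u] and one of [t]. *)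
rewrite (@cintegral_swap _ g (fun u => c * (M * (oneDsqr u)^-1)) (fun t => `|psi t|)).
- rewrite (_ : (fun _ => _) = fun=> 0).
    by rewrite /cintegral /Rintegral /= integral0 mulr0.
  by apply/funext => t; rewrite g0.
- rewrite (_ : (fun _ => _) = fun z => c * (Re (K 0 z.1) * cos (z.1 * z.2) +
      Im (K 0 z.1) * sin (z.1 * z.2)) * psi z.2).
    apply: measurable_funM => //; apply: measurable_funM => //.
    by apply: measurable_funD; apply: measurable_funM.
  apply/funext => z; rewrite /g fourier_charE; move: (K 0 z.1) => k.
  by rewrite !cpartE /=; ring.
- rewrite (_ : (fun _ => _) = fun z => c * (Im (K 0 z.1) * cos (z.1 * z.2) -
      Re (K 0 z.1) * sin (z.1 * z.2)) * psi z.2).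
    apply: measurable_funM => //; apply: measurable_funM => //.
    by apply: measurable_funB; apply: measurable_funM.
  apply/funext => z; rewrite /g fourier_charE; move: (K 0 z.1) => k.
  by rewrite !cpartE /=; ring.
- exact: iM.
- exact/integrable_norm/(integrable_compact_support cpsi psi0).
- move=> u t; rewrite /g; move: (K 0 u) (bK 0 u) => k bk.
  move: (fourier_char u t) (normc_fourier_char u t) => e e1.
  rewrite !ComplexField.Normc.normcM e1 mul1r !normc_real.
  by rewrite ger0_norm ?invr_ge0 ?sqrtr_ge0// ler_wpM2r// ler_wpM2l ?invr_ge0 ?sqrtr_ge0.
Qed.
End nsw.

Theorem theorem6 (R : realType) (N : nat) (c0 rho0 : R) (kappa tau : nat -> R) :
  (0 < N)%N -> 0 < c0 -> 0 < rho0 ->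
  (forall m : nat, (1 <= m <= N)%N -> 0 < kappa m /\ 0 < tau m) ->
  (forall m : nat, (1 <= m <= N)%N -> tautilde N c0 rho0 kappa tau m < tau m) ->
  causal_kernel (nsw_Khat N c0 rho0 kappa tau).
Proof. by move=> N0 c00 rho00 pos _; exact: nsw_kernel_causal. Qed.
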